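(* Let $P\subseteq\mathrm{Pref}(S)$ and let $f:P\to\mathbb N$ be a constant-time computable function with $f(p)=|n_{\mathrm{exit}(p)}|$ for every $p\in P$. If access to $S$ is available, then using an additional constant-time range locator for $S$ one can compute in constant time a function $\hat f:\{0,1\}^*\to\mathbb N\cup\{\bot\}$ such that $\hat f(p)=|n_{\mathrm{exit}(p)}|$ for all $p\in P$ and $\hat f(p)=\bot$ for all $p\notin\mathrm{Pref}(S)$.
   Context: Let $S$ be a set of $n$ binary strings of length $w$, stored as a sorted array $S[0],\dots,S[n-1]$ with constant-time access, in the word RAM model with $w$-bit words. $\mathrm{Pref}(S)$ is the set of all prefixes of elements of $S$; $\preceq$ is the prefix order; $x[i\..j)$ is the substring from position $i$ inclusive to $j$ exclusive. In the compacted trie of $S$, for a node $\alpha$: its extent $e_\alpha$ is the longest common prefix of the strings of $S$ at leaves below $\alpha$; $c_\alpha$ is the string labelling $\alpha$; the name $n_\alpha$ is $e_\alpha$ with suffix $c_\alpha$ removed. For a string $x$, $\mathrm{exit}(x)$ is the unique node $\alpha$ with $n_\alpha\preceq x$ and either $e_\alpha=x$ or $e_\alpha$ not a prefix of $x$. A range locator is a data structure that, given the name $n_\alpha$ of a node, returns the smallest index $\mathrm{left}(n_\alpha)$ and the largest index $\mathrm{right}(n_\alpha)$ in $S$ of the strings of $S$ having $n_\alpha$ as a prefix. *)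

(* Defs.v *)
From HB Require Import structures.
From mathcomp Require Import all_boot all_order.
From Stdlib Require PeanoNat.

Set Implicit Arguments.
Unset Strict Implicit.
Unset Printing Implicit Defensive.

Notation bits := (seq bool).

(** * Sets of strings and their compacted tries *)

Definition strings (w n : nat) (S : n.-tuple (w.-tuple bool)) : seq bits :=
  [seq val s | s <- S].

(* Strictly increasing in the lexicographic order (with 0 < 1), hence also
   duplicate-free. *)
Definition lex_sorted (S : seq bits) : bool :=
  sorted (fun x y : seqlexi bool => (x < y)%O) S.

(* Membership in Pref(S). *)
Definition Pref (S : seq bits) (x : bits) : bool := has (prefix x) S.

Fixpoint lcp2 (x y : bits) : bits :=
  match x, y with
  | a :: x', b :: y' => if a == b then a :: lcp2 x' y' else [::]
  | _, _ => [::]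
  end.

Definition lcp (S : seq bits) : bits := foldr lcp2 (head [::] S) S.

(* A node is identified with the subtrie it roots.  [c] is the string labelling
   the node; the bit distinguishing the two children of an internal node belongs
   to no label.  A leaf also records the string of S it stands for. *)
Inductive ctrie : Type :=
| Leaf (c s : bits)
| Node (c : bits) (l r : ctrie).

Lemma ctrie_comparable : comparable ctrie.
Proof. by rewrite /comparable /decidable; decide equality; apply: eq_comparable. Qed.

HB.instance Definition _ := hasDecEq.Build ctrie (compareP ctrie_comparable).

(* The compacted trie of the strings S, all of which share their first [d] bits,
   these being spelled above the root.  Branching splits S into two strictly
   smaller nonempty parts, so that [size S] is always enough fuel [k]. *)
Fixpoint build (k d : nat) (S : seq bits) : ctrie :=
  let e := lcp S in
  if (k, 1 < size S) is (k'.+1, true) then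
    let branch b := build k' (size e).+1 [seq s <- S | nth false s (size e) == b] in
    Node (drop d e) (branch false) (branch true)
  else Leaf (drop d e) (head [::] S).

Fixpoint subtries (t : ctrie) : seq ctrie :=
  t :: (if t is Node _ l r then subtries l ++ subtries r else [::]).

(* The compacted trie of the empty set has no node. *)
Definition nodes (S : seq bits) : seq ctrie :=
  if S is [::] then [::] else subtries (build (size S) 0 S).

Fixpoint leaves (a : ctrie) : seq bits :=
  match a with
  | Leaf _ s => [:: s]
  | Node _ l r => leaves l ++ leaves r
  end.

Definition label (a : ctrie) : bits :=
  match a with Leaf c _ => c | Node c _ _ => c end.

Definition extent (a : ctrie) : bits := lcp (leaves a).

Definition name (a : ctrie) : bits :=
  take (size (extent a) - size (label a)) (extent a).

(* [a] is exit(x); there is exactly one such node when x is in Pref(S). *)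
Definition is_exit (S : seq bits) (x : bits) (a : ctrie) : bool :=
  [&& a \in nodes S, prefix (name a) x
    & (extent a == x) || ~~ prefix (extent a) x].

Definition left (S : seq bits) (x : bits) : nat := find (prefix x) S.

Definition right (S : seq bits) (x : bits) : nat :=
  \max_(i < size S | prefix x (nth [::] S i)) i.

(** * The word RAM *)

Definition word (w : nat) : Type := 'I_(2 ^ w).

Lemma pow2_gt0 (w : nat) : 0 < 2 ^ w.
Proof. by rewrite expn_gt0. Qed.

Definition mkword (w m : nat) : word w := Ordinal (ltn_pmod m (pow2_gt0 w)).

(* The j-th w-bit block of x, first bit most significant, padded on the right
   with zeros. *)
Definition block (w : nat) (x : bits) (j : nat) : word w :=
  mkword w (foldl (fun v (b : bool) => v.*2 + b) 0
                  (mkseq (fun i => nth false x (j * w + i)) w)).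

Inductive binop : Type :=
| Add | Sub | Mul | Div | Mod | And | Or | Xor | Shl | Shr.

Definition eval_op (w : nat) (o : binop) (u v : word w) : word w :=
  mkword w
    match o with
    | Add => u + v
    | Sub => u + 2 ^ w - v
    | Mul => u * v
    | Div => u %/ v
    | Mod => u %% v
    | And => Nat.land u v
    | Or => Nat.lor u v
    | Xor => Nat.lxor u v
    | Shl => u * 2 ^ v
    | Shr => u %/ 2 ^ v
    end.

(* [d], [a], [b] are register numbers, [k] an array number, [m] a constant and
   [l] a jump target; R denotes the registers.  There are three kinds of
   storage besides R: the input string x and the array S, which are read-only
   and of known length, read-only arrays of words (the static data structures),
   and working arrays of words, initially zero. *)
Inductive instr : Type :=
| Const (d m : nat)         (* R[d] := m mod 2^w *)
| WordSize (d : nat)        (* R[d] := w *)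
| Move (d a : nat)          (* R[d] := R[a] *)
| Op (o : binop) (d a b : nat)   (* R[d] := R[a] o R[b] *)
| ReadMem (d k a : nat)        (* R[d] := (working array k)[R[a]] *)
| WriteMem (k a b : nat)       (* (working array k)[R[a]] := R[b] *)
| Fetch (d k a : nat)       (* R[d] := (static array k)[R[a]] *)
| GetS (d a : nat)          (* R[d] := S[R[a]], or 0 if out of bounds *)
| InputLen (d : nat)        (* R[d] := |x| mod 2^w *)
| InputBlock (d a : nat)    (* R[d] := R[a]-th w-bit block of x *)
| Jump (l : nat)
| JumpLt (a b l : nat)      (* jump if R[a] < R[b] *)
| JumpEq (a b l : nat)      (* jump if R[a] = R[b] *)
| JumpInS (a l : nat)       (* jump if R[a] < n *)
| JumpInInput (a l : nat)   (* jump if R[a] < |x| *)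
| Return (rs : seq nat).    (* halt, with output R[r] for r in rs *)

(* A program depends neither on w nor on S. *)
Definition program : Type := seq instr.

Record state (w : nat) : Type := State {
  pc : nat;
  reg : nat -> word w;
  mem : nat -> word w -> word w }.

Definition init (w : nat) : state w :=
  State 0 (fun=> mkword w 0) (fun _ _ => mkword w 0).

Definition set_reg (w : nat) (c : state w) (d : nat) (v : word w) : state w :=
  State (pc c).+1 (fun r => if r == d then v else reg c r) (mem c).

Definition set_mem (w : nat) (c : state w) (k : nat) (a v : word w) : state w :=
  State (pc c).+1 (reg c)
        (fun k' a' => if (k' == k) && (a' == a) then v else mem c k' a').

Definition jump_if (w : nat) (c : state w) (b : bool) (l : nat) : state w :=
  State (if b then l else (pc c).+1) (reg c) (mem c).

Definition step (w : nat) (S : seq bits) (D : nat -> word w -> word w)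
    (x : bits) (i : instr) (c : state w) : state w :=
  let R := reg c in
  match i with
  | Const d m => set_reg c d (mkword w m)
  | WordSize d => set_reg c d (mkword w w)
  | Move d a => set_reg c d (R a)
  | Op o d a b => set_reg c d (eval_op o (R a) (R b))
  | ReadMem d k a => set_reg c d (mem c k (R a))
  | WriteMem k a b => set_mem c k (R a) (R b)
  | Fetch d k a => set_reg c d (D k (R a))
  | GetS d a => set_reg c d (block w (nth [::] S (R a)) 0)
  | InputLen d => set_reg c d (mkword w (size x))
  | InputBlock d a => set_reg c d (block w x (R a))
  | Jump l => jump_if c true l
  | JumpLt a b l => jump_if c (R a < R b) l
  | JumpEq a b l => jump_if c (R a == R b) l
  | JumpInS a l => jump_if c (R a < size S) l
  | JumpInInput a l => jump_if c (R a < size x) l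
  | Return _ => c
  end.

(* The output after at most [t] steps; [None] if the program has not executed a
   [Return] by then, in particular if it ran off its last instruction. *)
Fixpoint run (w : nat) (S : seq bits) (D : nat -> word w -> word w)
    (A : program) (x : bits) (t : nat) (c : state w) : option (seq nat) :=
  if t is t'.+1 then
    match onth A (pc c) with
    | Some (Return rs) => Some [seq val (reg c r) | r <- rs]
    | Some i => run S D A x t' (step S D x i c)
    | None => None
    end
  else None.

(* With access to S and to the static data D, the program A computes g on the
   inputs satisfying Q in at most [t] steps; on other inputs it may output
   anything or fail to halt. *)
Definition computes (w : nat) (S : seq bits) (D : nat -> word w -> word w)
    (A : program) (t : nat) (Q : bits -> Prop) (g : bits -> seq nat) : Prop :=
  forall x, Q x -> run S D A x t (init w) = Some (g x).

Definition range_locator (w : nat) (S : seq bits) (D : nat -> word w -> word w)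
    (A : program) (t : nat) : Prop :=
  computes S D A t (fun x => exists2 a, a \in nodes S & x = name a)
           (fun x => [:: left S x; right S x]).

(* The undefined value is output as the empty sequence. *)
Definition out_opt (v : option nat) : seq nat :=
  if v is Some m then [:: m] else [::].

(* Main.v *)
Require Import Defs.
From mathcomp Require Import all_boot all_order.
From mathcomp Require Import zify.
Import Defs.

Set Implicit Arguments.
Unset Strict Implicit.
Unset Printing Implicit Defensive.

(* Run [Af] on x to get a candidate length m, then the range locator on the
   prefix of length m of x to get an index i, and answer m exactly when
   x is a prefix of S[i].  An answer thus certifies that x is in Pref(S).
   Conversely, when x is in P, that prefix is the name of exit(x), so S[i] lies
   below exit(x) and has its extent, hence x, as a prefix.  As [Af] and [Ar] come
   with constant time bounds, both calls are unrolled into one finite decision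
   tree: this cuts off nonterminating runs, and only inputs of at most w bits
   need to be handled, so that the input of the second call fits in a word. *)

(** * Compacted tries *)

Lemma prefix_lcp2 (x y z : bits) :
  prefix x (lcp2 y z) = prefix x y && prefix x z.
Proof.
elim: y x z => [|b y IH] [|a x] [|c z] //=; rewrite ?andbF ?prefix0s //.
case: (b =P c) => [<-|bc] /=; first by rewrite IH; case: (a == b); rewrite ?andbF.
by case: (a =P b) => [->|//]; case: eqP => //=; rewrite andbF.
Qed.

Lemma prefix_lcp (S : seq bits) (x : bits) :
  S != [::] -> prefix x (lcp S) = all (prefix x) S.
Proof.
have foldE z T : prefix x (foldr lcp2 z T) = all (prefix x) T && prefix x z.
  by elim: T => //= y T IH; rewrite prefix_lcp2 IH andbA.
(* The seed of the fold is the head of [S], itself a member of [S], so its condition is absorbed. *)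
by case: S => // y S _; rewrite /lcp foldE /= andbAC andbb.
Qed.

Lemma lcp_prefix (S : seq bits) (s : bits) : s \in S -> prefix (lcp S) s.
Proof.
move=> sS; have S0 : S != [::] by case: (S) sS.
by have := prefix_lcp (lcp S) S0; rewrite prefix_refl => /esym/allP; apply.
Qed.

Lemma prefix_anti (x y : bits) : prefix x y -> prefix y x -> x = y.
Proof.
by elim: x y => [|a x IH] [|b y] //= /andP[/eqP-> xy] /andP[_ yx]; rewrite (IH y).
Qed.

Lemma prefix_comparable (x y s : bits) :
  prefix x s -> prefix y s -> prefix x y || prefix y x.
Proof.
elim: s x y => [|c s IH] [|a x] [|b y] //= /andP[/eqP-> xs] /andP[/eqP-> ys].
by rewrite eqxx /= IH.
Qed.

Lemma eq_mem_neq0 (S T : seq bits) : S =i T -> S != [::] -> T != [::].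
Proof.
by case: S => // s S ST _; case: T ST => // /(_ s); rewrite mem_head.
Qed.

(** Extents are defined from leaves, and the leaves of a built trie are determined below only up to
    membership. *)
Lemma eq_lcp (S T : seq bits) : S =i T -> S != [::] -> lcp S = lcp T.
Proof.
move=> ST S0.
have T0 := eq_mem_neq0 ST S0.
by apply: prefix_anti; rewrite prefix_lcp //; apply/allP=> s;
  [rewrite -ST | rewrite ST] => /lcp_prefix.
Qed.

Section Build.

Variables (w : nat) (S : seq bits).
Hypotheses (uniqS : uniq S) (sizeS : {in S, forall s, size s = w}).

(** Otherwise two distinct strings of length [w] would both equal a common prefix of length [w]. *)
Lemma size_lcp_lt (T : seq bits) :
  uniq T -> {in T, forall s, size s = w} -> 1 < size T -> size (lcp T) < w.
Proof.
case: T => [|s [|t T]] // uT sT _.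
have ps := lcp_prefix (mem_head s (t :: T)).
have pt : prefix (lcp [:: s, t & T]) t by apply: lcp_prefix; rewrite !inE eqxx orbT.
have ss : size s = w by apply: sT; rewrite mem_head.
have st : size t = w by apply: sT; rewrite !inE eqxx orbT.
rewrite ltn_neqAle -{2}ss size_prefix // andbT; apply/eqP=> E.
move: ps pt; rewrite !prefixE E -{1}ss take_size -st take_size => /eqP st' /eqP tl.
by move: uT; rewrite /= {1}st' -tl mem_head.
Qed.

Definition branch (T : seq bits) (b : bool) : seq bits :=
  [seq s <- T | nth false s (size (lcp T)) == b].

Lemma prefix_branch (T : seq bits) (b : bool) (s : bits) :
  size (lcp T) < size s -> s \in T ->
  prefix (rcons (lcp T) b) s = (nth false s (size (lcp T)) == b).
Proof.
move=> lt_s sT; rewrite prefixE size_rcons (take_nth false) //.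
have := lcp_prefix sT; rewrite prefixE => /eqP->.
by rewrite eqseq_rcons eqxx.
Qed.

(** If side [b] were empty, every string of [T] would continue [lcp T] with [~~ b], giving a longer
    common prefix. *)
Lemma branch_neq0 (T : seq bits) (b : bool) :
  uniq T -> {in T, forall s, size s = w} -> 1 < size T -> branch T b != [::].
Proof.
move=> uT sT T1; have T0 : T != [::] by case: (T) T1.
have lt_w := size_lcp_lt uT sT T1.
apply/eqP=> E; have: prefix (rcons (lcp T) (~~ b)) (lcp T).
  rewrite prefix_lcp //; apply/allP=> s sIT.
  rewrite prefix_branch ?(sT s) //.
  have: s \notin branch T b by rewrite E.
  by rewrite mem_filter sIT andbT; case: (nth _ _ _) b {E} => [] [].
by move/size_prefix; rewrite size_rcons ltnn.
Qed.

Lemma size_branch (T : seq bits) (b : bool) :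
  uniq T -> {in T, forall s, size s = w} -> 1 < size T ->
  size (branch T b) < size T.
Proof.
move=> uT sT T1; have := branch_neq0 (~~ b) uT sT T1.
rewrite -size_eq0 -lt0n /branch !size_filter.
set p := fun s => nth false s _ == ~~ b => p0.
rewrite -(count_predC p T) -[X in X < _]add0n (eq_count (a2 := predC p)).
  by rewrite ltn_add2r.
by move=> s; rewrite /p /=; case: (nth _ _ _) (b) => [] [].
Qed.

(** The invariant of the recursion in [build]: no string of [S] outside [T] starts with the [d] bits
    spelled above the subtrie of [T]. *)
Definition closed_at (d : nat) (T : seq bits) : Prop :=
  forall s, s \in S -> prefix (take d (lcp T)) s -> s \in T.

(** Induction on the fuel. By closedness, a string of [S] that extends the name of a node lies below
    that node, so the extent, an lcp of leaves, is a prefix of it. *)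
Lemma build_spec (k d : nat) (T : seq bits) :
  T != [::] -> size T <= k -> uniq T -> {subset T <= S} ->
  d <= size (lcp T) -> closed_at d T ->
  leaves (build k d T) =i T /\
  forall a s, a \in subtries (build k d T) -> s \in S ->
    prefix (name a) s -> prefix (extent a) s.
Proof.
elim: k d T => [|k IH] d T T0 Tk uT TS dT clT; first by case: (T) T0 Tk.
have sT : {in T, forall s, size s = w} by move=> s /TS/sizeS.
have root a : leaves a =i T -> label a = drop d (lcp T) ->
    forall s, s \in S -> prefix (name a) s -> prefix (extent a) s.
  move=> la ca s sS.
  have a0 : leaves a != [::] by apply: eq_mem_neq0 T0 => t; rewrite la.
  (* The label omits the first [d] bits of [lcp T], so the name is [take d (lcp T)], the very prefix
     for which [T] is closed. *)
  rewrite /name /extent (eq_lcp la a0) ca size_drop subKn // => ns.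
  by apply: lcp_prefix; apply: clT.
rewrite /=; case: (ltnP 1 (size T)) => T1; last first.
  have [t Tt] : exists t, T = [:: t] by case: (T) T0 T1 => // t [] // _ _; exists t.
  have lT : leaves (Leaf (drop d (lcp T)) (head [::] T)) =i T by rewrite Tt.
  by split=> // a s; rewrite inE => /eqP->; apply: root.
have sub b : leaves (build k (size (lcp T)).+1 (branch T b)) =i branch T b /\
    forall a s, a \in subtries (build k (size (lcp T)).+1 (branch T b)) ->
      s \in S -> prefix (name a) s -> prefix (extent a) s.
  have b0 := branch_neq0 b uT sT T1.
  have lt_w := size_lcp_lt uT sT T1.
  have pb : prefix (rcons (lcp T) b) (lcp (branch T b)).
    rewrite prefix_lcp //; apply/allP=> s; rewrite mem_filter => /andP[sb sIT].
    by rewrite prefix_branch ?(sT s).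
  apply: IH => //.
  - by rewrite -ltnS (leq_trans (size_branch b uT sT T1)).
  - exact: filter_uniq.
  - by move=> s; rewrite mem_filter => /andP[_ /TS].
  - by have := size_prefix pb; rewrite size_rcons.
  (* The first [(size (lcp T)).+1] bits of the lcp of the branch are [rcons (lcp T) b]: its initial
     part puts [s] in [T], its last bit selects the branch. *)
  move=> s sS; have := pb; rewrite prefixE size_rcons => /eqP-> bs.
  have sIT : s \in T.
    apply: clT => //; apply: prefix_trans (prefix_trans (prefix_rcons (lcp T) b) bs).
    by apply: prefix_take.
  by rewrite mem_filter sIT andbT -prefix_branch ?(sizeS sS).
have [l0 s0] := sub false; have [l1 s1] := sub true.
rewrite -!/(branch T _).
set a0 := build _ _ _ in l0 s0 *; set a1 := build _ _ _ in l1 s1 *.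
have lT : leaves (Node (drop d (lcp T)) a0 a1) =i T.
  move=> s; rewrite /= mem_cat l0 l1 !mem_filter -andb_orl.
  by case: (nth _ _ _).
split=> // a s; rewrite inE mem_cat => /orP[/eqP->|/orP[]]; first exact: root.
- exact: s0.
- exact: s1.
Qed.

Lemma extent_prefix (a : ctrie) (s : bits) :
  a \in nodes S -> s \in S -> prefix (name a) s -> prefix (extent a) s.
Proof.
case E: {1 2}S => [|s0 S'] // aS; rewrite -E in aS *.
have S0 : S != [::] by rewrite E.
have aS' : a \in subtries (build (size S) 0 S) by move: aS; rewrite /nodes {1}E.
by have [|_] := build_spec S0 (leqnn _) uniqS (fun _ => id) (leq0n _); last exact.
Qed.

Lemma exit_left_prefix (p : bits) (a : ctrie) :
  Pref S p -> is_exit S p a ->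
  left S (name a) < size S /\ prefix p (nth [::] S (left S (name a))).
Proof.
move=> /hasP[s sS ps] /and3P[aS np ep].
have hasn : has (prefix (name a)) S by apply/hasP; exists s; last exact: prefix_trans ps.
split; first by rewrite -has_find.
have es := extent_prefix aS sS (prefix_trans np ps).
(* Both [p] and the extent are prefixes of [s], hence comparable; the exit condition excludes that
   the extent is a proper prefix of [p]. *)
have pe : prefix p (extent a).
  have := prefix_comparable ps es; case/orP: ep => [/eqP-> _|/negbTE->]; last by rewrite orbF.
  exact: prefix_refl.
apply: prefix_trans pe _; apply: extent_prefix => //.
- by rewrite mem_nth // -has_find.
- exact: nth_find.
Qed.

End Build.

(** * Bit strings as words *)

Definition bval (x : bits) : nat := foldl (fun v (b : bool) => v.*2 + b) 0 x.

Lemma bval_rcons (x : bits) (b : bool) : bval (rcons x b) = (bval x).*2 + b.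
Proof. by rewrite /bval foldl_rcons. Qed.

Lemma bval_cat (x y : bits) : bval (x ++ y) = bval x * 2 ^ size y + bval y.
Proof.
elim/last_ind: y => [|y b IH]; first by rewrite cats0 muln1 addn0.
rewrite -rcons_cat !bval_rcons IH size_rcons expnS; lia.
Qed.

Lemma bval_nseq (n : nat) : bval (nseq n false) = 0.
Proof. by elim: n => // n IH; rewrite nseqS bval_rcons IH. Qed.

Lemma bval_lt (x : bits) : bval x < 2 ^ size x.
Proof.
elim/last_ind: x => // x b IH; rewrite bval_rcons size_rcons expnS; lia.
Qed.

Lemma bval_take (m : nat) (x : bits) :
  m <= size x -> bval (take m x) = bval x %/ 2 ^ (size x - m).
Proof.
move=> mx; rewrite -{2}(cat_take_drop m x) bval_cat size_drop divnMDl ?expn_gt0 //.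
by rewrite divn_small ?addn0 // -size_drop bval_lt.
Qed.

Lemma bval_inj (x y : bits) : size x = size y -> bval x = bval y -> x = y.
Proof.
elim/last_ind: x y => [|x b IH] y; first by case: y.
case/lastP: y => [|y c]; rewrite !size_rcons // !bval_rcons => -[sxy] E.
have bc : b = c by case: b c E => [] [] //; lia.
by rewrite (IH y) // ?bc //; lia.
Qed.

Lemma block0 (w : nat) (x : bits) :
  size x <= w -> block w x 0 = bval x * 2 ^ (w - size x) :> nat.
Proof.
move=> xw; rewrite /block /= -/(bval _).
have -> : mkseq (fun i => nth false x (0 * w + i)) w = x ++ nseq (w - size x) false.
  apply: (@eq_from_nth _ false); rewrite size_mkseq.
    by rewrite size_cat size_nseq subnKC.
  move=> i iw; rewrite nth_mkseq // mul0n nth_cat nth_nseq.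
  by case: ltnP => // xi; rewrite nth_default ?if_same.
rewrite bval_cat bval_nseq size_nseq addn0 modn_small //.
by rewrite -{2}(subnKC xw) expnD ltn_pmul2r ?expn_gt0 ?bval_lt.
Qed.

Lemma block_out (w : nat) (x : bits) (j : nat) :
  size x <= w -> 0 < j -> block w x j = mkword w 0.
Proof.
move=> xw j0; congr mkword; rewrite -/(bval _) -(bval_nseq w); congr bval.
apply: (@eq_from_nth _ false); rewrite size_mkseq ?size_nseq // => i iw.
rewrite nth_mkseq // nth_nseq iw nth_default //; nia.
Qed.

(** Equality of lengths is essential: zero padding gives a string and its extension by zeros the
    same block. *)
Lemma block0_inj (w : nat) (x y : bits) :
  size x = size y -> size x <= w -> block w x 0 = block w y 0 -> x = y.
Proof.
move=> sxy xw /(congr1 (@nat_of_ord _)); rewrite !block0 -?sxy // => /eqP.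
by rewrite eqn_pmul2r ?expn_gt0 // => /eqP/(bval_inj sxy).
Qed.

Lemma mkword_id (w m : nat) : m < 2 ^ w -> mkword w m = m :> nat.
Proof. exact: modn_small. Qed.

Lemma mkword0 (w : nat) : mkword w 0 = 0 :> nat.
Proof. exact: mod0n. Qed.

Lemma word_gt0 (w : nat) (a : word w) : a != mkword w 0 -> 0 < a.
Proof.
by rewrite lt0n; apply: contra => /eqP a0; apply/eqP/val_inj; rewrite [LHS]a0 /= mod0n.
Qed.

Lemma ltn_word (w m : nat) : m <= w -> m < 2 ^ w.
Proof. by move/leq_ltn_trans; apply; apply: ltn_expl. Qed.

(** Shifting right and then left by [w - m] clears all but the [m] leading bits; for [m = 0] the
    shift by [w] yields 0, as it should. *)
Lemma truncate_block (w m : nat) (x : bits) (u v : word w) :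
  m <= size x -> size x <= w -> u = w :> nat -> v = m :> nat ->
  let h := eval_op Sub u v in
  eval_op Shl (eval_op Shr (block w x 0) h) h = block w (take m x) 0.
Proof.
move=> mx xw uE vE h; have mw := leq_trans mx xw.
have hE : h = w - m :> nat.
  by rewrite /= uE vE addnC -addnBA // modnDl modn_small // ltn_word ?leq_subr.
clearbody h; have bx : bval x * 2 ^ (w - size x) %/ 2 ^ (w - m) = bval (take m x).
  rewrite bval_take //.
  have -> : w - m = (w - size x) + (size x - m) by lia.
  by rewrite expnD mulnC divnMl ?expn_gt0.
have xE := block0 xw; apply: val_inj; rewrite [RHS]block0 ?size_takel //.
move: (block w x 0) xE => B /= ->; rewrite hE bx modnMml modn_small //.
have -> : 2 ^ w = 2 ^ m * 2 ^ (w - m) by rewrite -expnD subnKC.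
by rewrite ltn_pmul2r ?expn_gt0 // -[X in 2 ^ X](size_takel mx) bval_lt.
Qed.

(** * Decision trees *)

Inductive test : Type :=
| Lt (a b : nat) | Eq (a b : nat) | InS (a : nat) | InInput (a : nat).

Definition jump_on (c : test) (l : nat) : instr :=
  match c with
  | Lt a b => JumpLt a b l
  | Eq a b => JumpEq a b l
  | InS a => JumpInS a l
  | InInput a => JumpInInput a l
  end.

(** Programs without jump targets, so that composing them needs no relocation of addresses and
    reasoning is by structural induction. *)
Inductive tree : Type :=
| Ret (rs : seq nat)
| Do (i : instr) (t : tree)
| Branch (c : test) (t1 t0 : tree).

Definition straight (i : instr) : bool :=
  match i with
  | Jump _ | JumpLt _ _ _ | JumpEq _ _ _ | JumpInS _ _ | JumpInInput _ _
  | Return _ => false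
  | _ => true
  end.

Fixpoint wf (t : tree) : bool :=
  match t with
  | Ret _ => true
  | Do i t => straight i && wf t
  | Branch _ t1 t0 => wf t1 && wf t0
  end.

(** Jump targets are absolute, so [o] is the address at which the code is placed. A failed test
    falls through to [t0]. *)
Fixpoint compile (o : nat) (t : tree) : program :=
  match t with
  | Ret rs => [:: Return rs]
  | Do i t => i :: compile o.+1 t
  | Branch c t1 t0 =>
      let p0 := compile o.+1 t0 in
      jump_on c (o.+1 + size p0) :: p0 ++ compile (o.+1 + size p0) t1
  end.

Fixpoint depth (t : tree) : nat :=
  match t with
  | Ret _ => 1
  | Do _ t => (depth t).+1
  | Branch _ t1 t0 => (maxn (depth t1) (depth t0)).+1
  end.

Section Semantics.

Variables (w : nat) (S : seq bits) (D : nat -> word w -> word w).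

Definition holds (x : bits) (R : nat -> word w) (c : test) : bool :=
  match c with
  | Lt a b => R a < R b
  | Eq a b => R a == R b
  | InS a => R a < size S
  | InInput a => R a < size x
  end.

Fixpoint eval (x : bits) (t : tree) (c : state w) : seq nat :=
  match t with
  | Ret rs => [seq val (reg c r) | r <- rs]
  | Do i t => eval x t (step S D x i c)
  | Branch b t1 t0 => if holds x (reg c) b then eval x t1 c else eval x t0 c
  end.

Lemma eval_pc (x : bits) (t : tree) (c c' : state w) :
  wf t -> reg c = reg c' -> mem c = mem c' -> eval x t c = eval x t c'.
Proof.
elim: t c c' => [rs|i t IH|b t1 IH1 t0 IH0] c c' /=.
- by move=> _ ->.
- case/andP=> si wt rE mE; apply: IH => //; case: i si => //= *;
    by rewrite /set_reg /set_mem /= ?rE ?mE.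
- case/andP=> w1 w0 rE mE; rewrite (IH1 c c') // (IH0 c c') //.
  by rewrite rE.
Qed.

(** The surrounding code [pre] and [post] is arbitrary so that the induction applies to a subtree in
    the middle of the program. *)
Lemma run_compile (x : bits) (t : tree) (pre post : program) (n : nat)
    (c : state w) :
  wf t -> depth t <= n -> pc c = size pre ->
  run S D (pre ++ compile (size pre) t ++ post) x n c = Some (eval x t c).
Proof.
have onth_pre (p q : program) i : onth (p ++ i :: q) (size p) = Some i.
  by elim: p => //= a p IH.
elim: t pre post n c => [rs|i t IH|b t1 IH1 t0 IH0] pre post [|n] c //= wt dn pcE.
- by rewrite pcE onth_pre.
- case/andP: wt => si wt; rewrite pcE onth_pre.
  have pcE' : pc (step S D x i c) = size (rcons pre i).
    by rewrite size_rcons -pcE; case: (i) si.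
  have := IH (rcons pre i) post n _ wt dn pcE'.
  by rewrite size_rcons cat_rcons; case: (i) si.
case/andP: wt => w1 w0; move: dn; rewrite ltnS geq_max => /andP[d1 d0].
rewrite pcE onth_pre -catA; set p0 := compile _ t0.
set l := _ + size p0; set p1 := compile l t1.
(* Each of the four tests makes one step that is a conditional jump to [l]. *)
have -> : match jump_on b l with
    | Return rs => Some [seq val (reg c r) | r <- rs]
    | _ => run S D (pre ++ jump_on b l :: p0 ++ p1 ++ post) x n
             (step S D x (jump_on b l) c)
    end = run S D (pre ++ jump_on b l :: p0 ++ p1 ++ post) x n
             (jump_if c (holds x (reg c) b) l) by case: b.
case: ifP => hb.
- have := IH1 (rcons pre (jump_on b l) ++ p0) post n (jump_if c true l) w1 d1.
  rewrite size_cat size_rcons -/l -/p1 -catA cat_rcons => ->//.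
  by congr Some; apply: eval_pc.
- have := IH0 (rcons pre (jump_on b l)) (p1 ++ post) n (jump_if c false l) w0 d0.
  rewrite size_rcons -/p0 cat_rcons => ->; last by rewrite /= pcE.
  by congr Some; apply: eval_pc.
Qed.

End Semantics.

(** * Unrolling bounded runs *)

(* Registers 0 to 7 and the working array 0 belong to the caller; the two
   simulated programs, told apart by [b], share the rest by parity. *)
Definition var (b : bool) (r : nat) : nat := 8 + (r.*2 + b).
Definition arr (b : bool) (k : nat) : nat := (k.*2 + b).+1.

Notation rzero := 0 (only parsing).
Notation rw := 1 (only parsing).
Notation rlen := 2 (only parsing).
Notation rx := 3 (only parsing).
Notation rm := 4 (only parsing).
Notation rsize := 5 (only parsing).
Notation rh := 6 (only parsing).
Notation rtmp := 7 (only parsing).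

(* The simulated input y has length R[rlen] at most w.  Its only nonzero block
   is kept in cell 0 of the working array 0, whose other cells stay zero, so that
   block j can be read off cell j. *)
Definition translate (b : bool) (i : instr) : instr :=
  match i with
  | Const d m => Const (var b d) m
  | WordSize d => WordSize (var b d)
  | Move d a => Move (var b d) (var b a)
  | Op o d a a' => Op o (var b d) (var b a) (var b a')
  | ReadMem d k a => ReadMem (var b d) (arr b k) (var b a)
  | WriteMem k a a' => WriteMem (arr b k) (var b a) (var b a')
  | Fetch d k a => Fetch (var b d) k (var b a)
  | GetS d a => GetS (var b d) (var b a)
  | InputLen d => Move (var b d) rlen
  | InputBlock d a => ReadMem (var b d) 0 (var b a)
  | _ => i
  end.

(** The program counter [p] of [A] is known statically along each path, so jumps of [A] vanish. The
    continuation [k] receives the registers holding the output. [JumpInInput] compares with [rlen]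
    because the simulated input may differ from the real one. *)
Fixpoint unroll (b : bool) (A : program) (k : seq nat -> tree) (t p : nat) :
    tree :=
  if t is t'.+1 then
    match onth A p with
    | None => Ret [::]
    | Some (Return rs) => k [seq var b r | r <- rs]
    | Some (Jump l) => unroll b A k t' l
    | Some (JumpLt a a' l) =>
        Branch (Lt (var b a) (var b a')) (unroll b A k t' l) (unroll b A k t' p.+1)
    | Some (JumpEq a a' l) =>
        Branch (Eq (var b a) (var b a')) (unroll b A k t' l) (unroll b A k t' p.+1)
    | Some (JumpInS a l) =>
        Branch (InS (var b a)) (unroll b A k t' l) (unroll b A k t' p.+1)
    | Some (JumpInInput a l) =>
        Branch (Lt (var b a) rlen) (unroll b A k t' l) (unroll b A k t' p.+1)
    | Some i => Do (translate b i) (unroll b A k t' p.+1)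
    end
  else Ret [::].

Lemma wf_unroll (b : bool) (A : program) (k : seq nat -> tree) (t p : nat) :
  (forall rs, wf (k rs)) -> wf (unroll b A k t p).
Proof.
by move=> wk; elim: t p => //= t IH p; case: onth => [[]|] //= *; rewrite ?IH.
Qed.

Lemma var_eq (b : bool) (r r' : nat) : (var b r == var b r') = (r == r').
Proof. rewrite /var; lia. Qed.

Lemma arr_eq (b : bool) (k k' : nat) : (arr b k == arr b k') = (k == k').
Proof. rewrite /arr; lia. Qed.

Section Simulation.

Variables (w : nat) (S : seq bits) (D : nat -> word w -> word w).

Definition simulates (b : bool) (c s : state w) : Prop :=
  (forall r, reg c (var b r) = reg s r) /\
  (forall k a, mem c (arr b k) a = mem s k a).

Definition loaded (y : bits) (c : state w) : Prop :=
  [/\ size y <= w, reg c rlen = mkword w (size y)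
    & forall a : word w, mem c 0 a = block w y a].

(** What a simulation with parity [b] preserves: the storage of the caller and that of the other
    simulated program. *)
Definition frame (b : bool) (c c' : state w) : Prop :=
  (forall r, (forall r', r != var b r') -> reg c' r = reg c r) /\
  (forall k, (forall k', k != arr b k') -> mem c' k =1 mem c k).

Lemma frame_trans (b : bool) (c1 c2 c3 : state w) :
  frame b c1 c2 -> frame b c2 c3 -> frame b c1 c3.
Proof.
move=> [r12 m12] [r23 m23]; split=> [r hr|k hk a].
- by rewrite r23 // r12.
- by rewrite m23 // m12.
Qed.

Lemma frame_reg (b : bool) (c c' : state w) (r : nat) :
  frame b c c' -> r < 8 -> reg c' r = reg c r.
Proof. by move=> [fr _] r8; apply: fr => r'; rewrite /var; lia. Qed.

Lemma frame_mem0 (b : bool) (c c' : state w) :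
  frame b c c' -> mem c' 0 =1 mem c 0.
Proof. by move=> [_ fm]; apply: fm. Qed.

Lemma frame_loaded (b : bool) (c c' : state w) (y : bits) :
  frame b c c' -> loaded y c -> loaded y c'.
Proof.
move=> fr [yw lE mE]; split=> // [|a]; first by rewrite (frame_reg fr).
by rewrite (frame_mem0 fr).
Qed.

Lemma frame_simulates (b : bool) (c c' s : state w) :
  frame b c c' -> simulates (~~ b) c s -> simulates (~~ b) c' s.
Proof.
move=> [fr fm] [sr sm]; split=> [r|k a].
- by rewrite fr // => r'; rewrite /var; case: b {fr fm sr sm} => /=; lia.
- by rewrite fm // => k'; rewrite /arr; case: b {fr fm sr sm} => /=; lia.
Qed.

Lemma set_reg_simulates (b : bool) (c s : state w) (d : nat) (v : word w) :
  simulates b c s -> simulates b (set_reg c (var b d) v) (set_reg s d v).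
Proof. by move=> [sr sm]; split=> //= r; rewrite var_eq sr. Qed.

Lemma set_mem_simulates (b : bool) (c s : state w) (k : nat) (a v : word w) :
  simulates b c s -> simulates b (set_mem c (arr b k) a v) (set_mem s k a v).
Proof. by move=> [sr sm]; split=> //= k' a'; rewrite arr_eq sm. Qed.

Lemma set_reg_frame (b : bool) (c : state w) (d : nat) (v : word w) :
  frame b c (set_reg c (var b d) v).
Proof. by split=> //= r /(_ d)/negbTE->. Qed.

Lemma set_mem_frame (b : bool) (c : state w) (k : nat) (a v : word w) :
  frame b c (set_mem c (arr b k) a v).
Proof. by split=> //= k' /(_ k)/negbTE-> a'. Qed.

Lemma step_translate (b : bool) (x y : bits) (i : instr) (c s : state w) :
  straight i -> loaded y c -> simulates b c s ->
  simulates b (step S D x (translate b i) c) (step S D y i s) /\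
  frame b c (step S D x (translate b i) c).
Proof.
move=> si [yw lE mE] sim; have [sr sm] := sim.
case: i si => //= *; rewrite ?sr ?sm ?lE ?mE;
  by split; [exact: set_reg_simulates || exact: set_mem_simulates
            | exact: set_reg_frame || exact: set_mem_frame].
Qed.

(** Induction on the time bound, with [F] the meaning of the continuation; a run that is cut off or
    falls off the program gives the empty output, that is, the undefined value. *)
Lemma eval_unroll (b : bool) (A : program) (k : seq nat -> tree)
    (F : seq nat -> seq nat) (x y : bits) (t : nat) (c s : state w) :
  loaded y c -> simulates b c s ->
  (forall rs c', frame b c c' ->
     eval S D x (k rs) c' = F [seq val (reg c' r) | r <- rs]) ->
  eval S D x (unroll b A k t (pc s)) c = oapp F [::] (run S D A y t s).
Proof.
elim: t c s => [|t IH] c s ld sim kF //=.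
have [sr _] := sim.
have straightE i : straight i ->
    eval S D x (Do (translate b i) (unroll b A k t (pc s).+1)) c =
    oapp F [::] (run S D A y t (step S D y i s)).
  move=> si; have [sim' fr] := step_translate x si ld sim.
  rewrite /= -(_ : pc (step S D y i s) = (pc s).+1); last by case: (i) si.
  apply: IH => //; first exact: frame_loaded fr ld.
  by move=> rs c' fr'; apply: kF; apply: frame_trans fr fr'.
have jumpE (v : bool) l : eval S D x
      (if v then unroll b A k t l else unroll b A k t (pc s).+1) c =
    oapp F [::] (run S D A y t (jump_if s v l)).
  by have := IH c (jump_if s v l) ld sim kF; case: v.
case: (onth A (pc s)) => [i|] //.
case: i => [d m|d|d a|o d a a'|d n a|n a a'|d n a|d a|d|d a|l|a a' l|a a' l|a l|a l|rs];
  try exact: straightE.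
- exact: (jumpE true).
- by rewrite -jumpE /= !sr; case: ifP.
- by rewrite -jumpE /= !sr; case: ifP.
- by rewrite -jumpE /= !sr; case: ifP.
(* [rlen] holds the exact length of [y], since [size y <= w < 2 ^ w]. *)
- have [yw lE _] := ld; rewrite -jumpE /= !sr lE mkword_id ?ltn_word //.
  by case: ifP.
- by rewrite kF //= -map_comp; congr F; apply: eq_map => r /=; rewrite sr.
Qed.

End Simulation.

(** * The checked function *)

Definition truncate (d a len : nat) (t : tree) : tree :=
  Do (Op Sub rh rw len) (Do (Op Shr rtmp a rh) (Do (Op Shl d rtmp rh) t)).

Definition verify (rs : seq nat) : tree :=
  if rs is r :: _ then
    Branch (InS r)
      (Do (GetS rtmp r) (truncate rtmp rtmp rsize
         (Branch (Eq rtmp rx) (Ret [:: rm]) (Ret [::]))))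
      (Ret [::])
  else Ret [::].

(** A candidate longer than [x] is rejected. Otherwise the prefix becomes the new simulated input,
    after the length of [x] is saved in [rsize] for the final check. *)
Definition locate (Ar : program) (tr : nat) (rs : seq nat) : tree :=
  if rs is r :: _ then
    Do (Move rm r) (Branch (Lt rlen rm) (Ret [::])
      (truncate rtmp rx rm
        (Do (WriteMem 0 rzero rtmp) (Do (Move rsize rlen) (Do (Move rlen rm)
          (unroll true Ar verify tr 0))))))
  else Ret [::].

(** The test [InInput rw] rejects inputs longer than [w], which are never prefixes of strings of
    [S]. *)
Definition checked (Af Ar : program) (tf tr : nat) : tree :=
  Do (WordSize rw) (Branch (InInput rw) (Ret [::])
    (Do (InputLen rlen) (Do (InputBlock rx rzero) (Do (WriteMem 0 rzero rx)
      (unroll false Af (locate Ar tr) tf 0))))).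

Lemma wf_checked (Af Ar : program) (tf tr : nat) : wf (checked Af Ar tf tr).
Proof.
apply: wf_unroll => -[|r rs] //=; apply: wf_unroll => -[|r' rs'] //.
Qed.

Section Checked.

Variables (w : nat) (S : seq bits) (D : nat -> word w -> word w).
Variables (Af Ar : program) (tf tr : nat).
Hypothesis sizeS : {in S, forall s, size s = w}.

Definition verified (x : bits) (m : nat) (out : seq nat) : option nat :=
  if out is i :: _ then
    if (i < size S) && prefix x (nth [::] S i) then Some m else None
  else None.

Definition located (x : bits) (out : seq nat) : option nat :=
  if out is m :: _ then
    if m <= size x then
      obind (verified x m) (run S D Ar (take m x) tr (init w))
    else None
  else None.

Definition checked_fun (x : bits) : option nat :=
  if size x <= w then obind (located x) (run S D Af x tf (init w)) else None.

Lemma out_obind (g : seq nat -> option nat) (v : option (seq nat)) :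
  out_opt (obind g v) = oapp (fun out => out_opt (g out)) [::] v.
Proof. by case: v. Qed.

Lemma eval_verify (x : bits) (m : nat) (rs : seq nat) (c : state w) :
  size x <= w ->
  reg c rw = mkword w w -> reg c rsize = mkword w (size x) ->
  reg c rx = block w x 0 -> reg c rm = m :> nat ->
  eval S D x (verify rs) c = out_opt (verified x m [seq val (reg c r) | r <- rs]).
Proof.
move=> xw wE nE xE mE; case: rs => [|r rs] //=.
case: ltnP => //= iS; set s := nth _ _ _.
have ss : size s = w by apply: sizeS; rewrite mem_nth.
have := @truncate_block w (size x) s (reg c rw) (reg c rsize).
rewrite wE nE xE ss !mkword_id ?ltn_word // => /(_ xw (leqnn _) erefl erefl) /= ->.
(* Both strings have length [size x], so comparing one word decides the prefix relation. *)
have -> : (block w (take (size x) s) 0 == block w x 0) = prefix x s.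
  rewrite prefixE; apply/eqP/eqP => [/block0_inj->|->] //.
  - by rewrite size_takel ?ss.
  - by rewrite size_takel ?ss.
by case: ifP => //= _; rewrite mE.
Qed.

Lemma eval_locate (x : bits) (rs : seq nat) (c : state w) :
  loaded x c -> simulates true c (init w) ->
  reg c rzero = mkword w 0 -> reg c rw = mkword w w -> reg c rx = block w x 0 ->
  eval S D x (locate Ar tr rs) c =
  out_opt (located x [seq val (reg c r) | r <- rs]).
Proof.
move=> [xw lE mE] [sr sm] zE wE xE; case: rs => [|r rs] //=.
rewrite lE mkword_id ?ltn_word // ltnNge.
case: leqP => //= mx; set m := val (reg c r) in mx *.
rewrite out_obind; set c' := set_reg _ rlen _.
have tE := truncate_block mx xw (mkword_id (ltn_word (leqnn w))) (erefl m).
have ld : loaded (take m x) c'.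
  split; rewrite /= ?size_takel //; first exact: leq_trans xw.
  - by apply: val_inj; rewrite /= modn_small ?ltn_ord.
  (* Only cell 0 is overwritten; the others still hold the later blocks of [x], which are zero, as
     are those of its prefix. *)
  move=> a; rewrite /= zE; case: (a =P mkword w 0) => [->|/eqP a0].
  - by rewrite wE xE mkword0 -tE.
  by rewrite mE !block_out ?word_gt0 ?size_takel //; apply: leq_trans xw.
apply: (@eval_unroll w S D true Ar verify _ x (take m x) tr c' (init w)) => //.
move=> rs' c'' fr; apply: eval_verify => //; by rewrite (frame_reg fr).
Qed.

Lemma eval_checked (x : bits) :
  eval S D x (checked Af Ar tf tr) (init w) = out_opt (checked_fun x).
Proof.
rewrite /= /checked_fun modn_small ?ltn_word // ltnNge.
case: leqP => //= xw; rewrite out_obind; set c := set_mem _ _ _ _.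
have ld : loaded x c.
  split=> // a; rewrite /= mod0n; case: (a =P mkword w 0) => [->|/eqP a0].
  - by rewrite mkword0.
  by rewrite block_out ?word_gt0.
apply: (@eval_unroll w S D false Af (locate Ar tr) _ x x tf c (init w)) => //.
move=> rs c' fr; apply: eval_locate.
- exact: frame_loaded fr ld.
(* Running [Af] leaves the odd registers and arrays at zero, so [Ar] starts from its initial
   state. *)
- by apply: (frame_simulates fr).
- by rewrite (frame_reg fr).
- by rewrite (frame_reg fr).
- by rewrite (frame_reg fr) //= mod0n.
Qed.

Lemma checked_fun_Pref (x : bits) (m : nat) : checked_fun x = Some m -> Pref S x.
Proof.
rewrite /checked_fun; case: ifP => // _; case: run => [[|m' out]|] //=.
case: ifP => // _; case: run => [[|i out']|] //=.
by case: ifP => // /andP[iS xs] _; apply/hasP; exists (nth [::] S i); rewrite ?mem_nth.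
Qed.

Lemma checked_fun_exit (x : bits) (a : ctrie) :
  uniq S -> Pref S x -> is_exit S x a ->
  run S D Af x tf (init w) = Some [:: size (name a)] ->
  range_locator S D Ar tr ->
  checked_fun x = Some (size (name a)).
Proof.
move=> uS xS xa fE loc.
have [s sIS xs] := hasP xS.
have xw : size x <= w by rewrite -(sizeS sIS) size_prefix.
have [aS nx _] := and3P xa.
have nE : take (size (name a)) x = name a by apply/eqP; rewrite -prefixE.
have [lS px] := exit_left_prefix uS sizeS xS xa.
rewrite /checked_fun xw fE /= size_prefix // nE loc; last by exists a.
by rewrite /= lS px.
Qed.

End Checked.

Theorem theorem3 (Af Ar : program) (tf tr : nat) :
  exists (B : program) (t : nat),
  forall (w n : nat) (S : n.-tuple (w.-tuple bool))
         (D : nat -> word w -> word w) (P : bits -> Prop) (f : bits -> nat),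
    lex_sorted (strings S) ->
    (forall p, P p -> Pref (strings S) p) ->
    (forall p, P p ->
       exists2 a, is_exit (strings S) p a & f p = size (name a)) ->
    computes (strings S) D Af tf P (fun p => [:: f p]) ->
    range_locator (strings S) D Ar tr ->
    exists fhat : bits -> option nat,
      [/\ computes (strings S) D B t (fun=> True) (fun x => out_opt (fhat x)),
          forall p, P p ->
            exists2 a, is_exit (strings S) p a & fhat p = Some (size (name a))
        & forall p, ~~ Pref (strings S) p -> fhat p = None].
Proof.
set T := checked Af Ar tf tr.
(* Program and time bound come from [Af], [Ar], [tf] and [tr] alone, before [w], [S] and [D] are
   introduced: the time is constant. *)
exists (compile 0 T), (depth T) => w n S D P f sortS PS fP fE loc.
have sizeS : {in strings S, forall s, size s = w}.
  by move=> s /mapP[u _ ->]; rewrite size_tuple.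
have uS : uniq (strings S).
  apply: (@sorted_uniq (seqlexi bool) (fun x y => (x < y)%O)) sortS.
  - exact: Order.POrderTheory.lt_trans.
  - exact: Order.POrderTheory.ltxx.
exists (checked_fun (strings S) D Af Ar tf tr); split.
- move=> x _; rewrite -eval_checked //.
  have := run_compile (strings S) D x (pre := [::]) [::] (c := init w)
    (wf_checked Af Ar tf tr) (leqnn _) erefl.
  by rewrite cats0.
- move=> p Pp; have [a pa fpa] := fP p Pp; exists a => //.
  apply: checked_fun_exit => //; first exact: PS.
  by rewrite fE // fpa.
- move=> p; case E: checked_fun => [m|] // /negP[].
  exact: checked_fun_Pref E.
Qed.
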